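(* There is an absolute constant $K$ such that for every non-empty reduced word $w$ over $\{a,a^{-1},b,b^{-1}\}$, there exist a labelled permutation digraph $D$ with at most $\frac{2}{5}|w|+K$ vertices and a vertex $v$ of $D$ such that the $(w,v)$-walk on $D$ is non-closed (that is, it does not end at $v$).
   Context: Words are reduced words over $\{a,a^{-1},b,b^{-1}\}$ (elements of the free group $F_2=\langle a,b\rangle$), and $|w|$ is the length of $w$. A labelled permutation digraph $D$ consists of a finite vertex set and, for each $C\in\{a,b\}$, exactly one outgoing and one incoming directed edge labelled $C$ at every vertex (loops are allowed). Thus the $C$-edges form the directed cycles of a permutation of the vertex set, and $D$ amounts to an ordered pair of permutations of the vertex set. Given a word $w=s_1\dots s_\ell$ and a vertex $v$ of $D$, the $(w,v)$-walk is the walk that starts at $v$ and successively reads the letters $s_1,\dots,s_\ell$: if $s_i=C$ it follows the outgoing $C$-edge at the current vertex, and if $s_i=C^{-1}$ it follows the incoming $C$-edge (backwards), where $C\in\{a,b\}$. The walk is closed if it ends at $v$, and non-closed otherwise. *)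

(* Defs.v *)
From HB Require Import structures.
From mathcomp Require Import all_boot all_order all_algebra all_fingroup.
Set Implicit Arguments.
Unset Strict Implicit.
Unset Printing Implicit Defensive.

Inductive generator := gen_a | gen_b.

Definition bool_of_generator (C : generator) : bool :=
  if C is gen_a then true else false.
Definition generator_of_bool (c : bool) : generator :=
  if c then gen_a else gen_b.
Lemma bool_of_generatorK : cancel bool_of_generator generator_of_bool.
Proof. by case. Qed.
HB.instance Definition _ :=
  Equality.copy generator (can_type bool_of_generatorK).

(* [(C, false)] is the letter C and [(C, true)] is the letter C^-1. *)
Definition letter : Type := (generator * bool)%type.

Definition letter_inv (s : letter) : letter := (s.1, ~~ s.2).

Definition reduced (w : seq letter) : bool :=
  sorted (fun s t : letter => t != letter_inv s) w.

(* The edges labelled C are the pairs (x, edge C x): having exactly one outgoing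
   and exactly one incoming C-edge at each vertex means that the C-edges form the
   graph of a permutation. *)
Record lpdigraph := LPDigraph {
  vertex : finType;
  edge : generator -> {perm vertex}
}.

Definition step (D : lpdigraph) (x : vertex D) (s : letter) : vertex D :=
  if s.2 then (edge D s.1)^-1%g x else edge D s.1 x.

(* The vertices visited after v, in order; the letters of w are read from left
   to right. *)
Definition walk (D : lpdigraph) (w : seq letter) (v : vertex D) :
    seq (vertex D) :=
  scanl (@step D) v w.

Definition closed_walk (D : lpdigraph) (w : seq letter) (v : vertex D) : Prop :=
  last v (walk w v) = v.

(* Main.v *)
Require Import Defs.
From mathcomp Require Import all_boot all_order all_algebra all_fingroup all_field.
From mathcomp Require Import ring lra zify.
Set Implicit Arguments.
Unset Strict Implicit.
Unset Printing Implicit Defensive.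
Import Order.TTheory GRing.Theory Num.Theory.

(** Let g be the generator occurring in fewer letters of w, so that w has
    n <= |w| / 2 letters g or g^-1.  Over a finite field F of odd order q, let g
    act on the projective line by the matrix with rows (1, v) and (1, 1), where
    v <> 1, and let the other generator act by diag(z, 1), where z is a primitive
    root.  This is a permutation digraph with q + 1 vertices.  Applying w to the
    vector (1, 0) gives a vector whose second coordinate Y is a polynomial in v,
    and the walk from (1 : 0) is non-closed as soon as Y(v) <> 0.

    - deg Y <= (n - 1) / 2 ([size_act_poly]): if r is a square root of v, the
      matrix of g is conjugate under diag(r, 1) to the one with rows (1, r) and
      (r, 1), so a letter contributes half a degree in v.
    - Y(1) <> 0 ([act1_neq0]): at v = 1 the matrices of g and g^-1 have rank one,
      and Y(1) is, up to sign and a power of z, a product of factors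
      z^(+-l) +- 1, one for each maximal block of l letters, possibly none,
      between two letters g^(+-1); a factor can only vanish if l > 0 and q - 1
      divides 2l, or if l = 0 and g meets g^-1, which a reduced word excludes.

    So if q - 1 divides no 2l with l > 0 and n <= 2 (q - 1), then Y is nonzero and has fewer
    than q - 1 roots, and one of the q - 1 parameters v <> 1 gives the digraph
    ([nonclosed_digraph]).

    It remains to choose q.  As n <= |w| / 2, any prime q with
    |w| / 4 + 1 <= q <= 2 |w| / 5 fits the degree bound and the vertex count.  For
    such q, q - 1 can divide 2l only if l >= |w| / 8; there are at most 8 such
    blocks, each with at most 8 relevant quotients 2l / (q - 1), hence at most 64
    bad primes ([exists_good_modulus]).  Since 8/5 exceeds 3/2, it is enough to
    have more than 64 primes between 20 k and 30 k for all large k, where k is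
    about |w| / 75; this is an estimate of Chebyshev type ([many_primes]).  Words
    of bounded length are handled by a single large prime, whose size is absorbed
    by the additive constant. *)

(** * Products of primes in an interval *)

Definition primeprod (a b : nat) : nat := \prod_(a.+1 <= p < b.+1 | prime p) p.

Lemma dvdn_from_logn m n :
  0 < m -> 0 < n -> (forall p, prime p -> logn p m <= logn p n) -> m %| n.
Proof.
move=> m0 n0 h; apply/dvdn_partP => // p; rewrite mem_primes => /andP[pp _].
by rewrite p_part pfactor_dvdn // h.
Qed.

Lemma primeprod_gt0 a b : 0 < primeprod a b.
Proof. by apply: prodn_cond_gt0 => p /prime_gt0. Qed.

Lemma logn_primeprod q a b : prime q -> logn q (primeprod a b) = (a < q <= b).
Proof.
move=> pq; rewrite /primeprod -big_filter.
have -> : (a < q <= b) = (q \in [seq p <- index_iota a.+1 b.+1 | prime p]).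
  by rewrite mem_filter pq mem_index_iota ltnS.
have: uniq [seq p <- index_iota a.+1 b.+1 | prime p] by rewrite filter_uniq ?iota_uniq.
have: all prime [seq p <- index_iota a.+1 b.+1 | prime p] by rewrite filter_all.
elim: [seq _ <- _ | _] => [|p s IH] /=; first by rewrite big_nil logn1.
case/andP=> pp ps /andP[pns us].
have s0 : 0 < \prod_(j <- s) j.
  by rewrite big_seq_cond prodn_cond_gt0 // => i /andP[/(allP ps)/prime_gt0].
rewrite big_cons lognM // ?(prime_gt0 pp) // logn_prime // IH // in_cons.
by case: eqP => //= ->; rewrite (negPf pns).
Qed.

Lemma primeprod_dvd a b m :
  0 < m -> (forall p, prime p -> a < p <= b -> p %| m) -> primeprod a b %| m.
Proof.
move=> m0 h; apply: (dvdn_from_logn (primeprod_gt0 a b) m0) => p pp.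
rewrite logn_primeprod //; case ab: (a < p <= b) => //.
by rewrite -pfactor_dvdn // expn1 h.
Qed.

Lemma primeprodM a b c : a <= b <= c -> primeprod a c = primeprod a b * primeprod b c.
Proof. by move=> ?; rewrite /primeprod -big_cat_nat //=; lia. Qed.

Lemma dvdn_fact_prime p n : prime p -> (p %| n`!) = (p <= n).
Proof.
move=> pp; apply/idP/idP => [|h]; last by rewrite dvdn_fact // prime_gt0.
elim: n => [|n IH]; first by rewrite fact0 Euclid_dvd1.
rewrite factS Euclid_dvdM // => /orP[/dvdn_leq->//|/IH]; lia.
Qed.

Lemma prime_dvd_bin p n k :
  prime p -> k <= n -> k < p -> n - k < p -> p <= n -> p %| 'C(n, k).
Proof.
move=> pp kn h1 h2 h3.
have : p %| 'C(n, k) * (k`! * (n - k)`!) by rewrite bin_fact // dvdn_fact_prime.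
rewrite Euclid_dvdM // => /orP[//|].
rewrite Euclid_dvdM // => /orP[]; rewrite dvdn_fact_prime //; lia.
Qed.

(** The exponent gains 1 over the trivial bound 2 ^ n: this exactly pays for the
    rounding of n/2 in [primorial_le]. *)
Lemma bin_leq_exp2 n k : 'C(n.+1, k) <= 2 ^ n.
Proof.
elim: n k => [|n IH] [|k]; rewrite ?bin0 ?expn_gt0 //.
  by case: k => [|k]; rewrite ?bin1 ?bin_small.
by rewrite binS expnS mul2n -addnn leq_add.
Qed.

(** The primes in (n/2, n] all divide one binomial coefficient, which is at most
    2 ^ (n - 1); iterating on the lower half gives a geometric bound. *)
Lemma primorial_le n : primeprod 0 n <= 4 ^ n.
Proof.
elim/ltn_ind: n => -[|[|n]] IH.
- by rewrite /primeprod big_geq.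
- by rewrite /primeprod big_mkcond big_nat1.
have hn : uphalf n.+2 < n.+2 by rewrite uphalfE; lia.
rewrite (@primeprodM 0 (uphalf n.+2)); last by lia.
have : primeprod (uphalf n.+2) n.+2 <= 2 ^ n.+1.
  apply: leq_trans (bin_leq_exp2 n.+1 (uphalf n.+2)).
  apply: dvdn_leq; first by rewrite bin_gt0; lia.
  apply: primeprod_dvd; first by rewrite bin_gt0; lia.
  by move=> p pp; rewrite uphalfE => hp; apply: prime_dvd_bin => //; lia.
move=> /(leq_mul (IH _ hn)) h; apply: leq_trans h _.
rewrite (_ : 4 = 2 ^ 2) // -!expnM -expnD leq_exp2l // uphalfE; lia.
Qed.

Lemma logn_fact_widen p n M :
  prime p -> n <= M -> logn p n`! = \sum_(1 <= j < M.+1) n %/ p ^ j.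
Proof.
move=> pp nM; rewrite logn_fact // [RHS](@big_cat_nat _ _ _ n.+1) //=.
rewrite [X in _ = _ + X]big_nat_cond [X in _ = _ + X]big1 ?addn0 // => j /andP[/andP[h _] _].
by rewrite divn_small // (leq_trans h) // ltnW // ltn_expl // prime_gt1.
Qed.

(** * A Chebyshev estimate *)

(** For W = floor(6x), this is floor(6x) + floor(x) - floor(3x) - 2 floor(2x) when
    W <= 5, and an upper bound of it in general.  By Legendre's formula, summing
    that expression over x = n / p^j, j >= 1, gives the p-adic valuation of
    (6n)! n! / ((3n)! (2n)!^2). *)
Definition chebyshev_coef (W : nat) : nat := (0 < W) && (W \notin [:: 3; 4]).

(** The four quotients are determined by the first: floor(3n/q), floor(2n/q) and
    floor(n/q) are floor(6n/q) divided by 2, 3 and 6. *)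
Lemma div_chebyshev_coef n q :
  (6 * n) %/ q + n %/ q <= (3 * n) %/ q + 2 * ((2 * n) %/ q) + chebyshev_coef ((6 * n) %/ q).
Proof.
have -> : n %/ q = ((6 * n) %/ q) %/ 6.
  by rewrite -divnMA [q * _]mulnC divnMA; congr (_ %/ _); lia.
have -> : (3 * n) %/ q = ((6 * n) %/ q) %/ 2.
  by rewrite -divnMA [q * _]mulnC divnMA; congr (_ %/ _); lia.
have -> : (2 * n) %/ q = ((6 * n) %/ q) %/ 3.
  by rewrite -divnMA [q * _]mulnC divnMA; congr (_ %/ _); lia.
move: (6 * n %/ q) => W; rewrite /chebyshev_coef !inE; lia.
Qed.

Lemma sum_chebyshev_coef_le p n T :
  prime p -> \sum_(1 <= j < T) chebyshev_coef (n %/ p ^ j) <= trunc_log p n.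
Proof.
move=> pp; apply: (@leq_trans (\sum_(1 <= j < T) (j <= trunc_log p n))).
  apply: leq_sum => j _; have [n0|] := posnP (n %/ p ^ j); first by rewrite n0.
  rewrite divn_gt0 ?expn_gt0 ?prime_gt0 // => /(trunc_log_max (prime_gt1 pp)) ->.
  by rewrite leq_b1.
move: (trunc_log p n) => t.
suff: \sum_(1 <= j < T) (j <= t) <= minn t T.-1 by lia.
elim: T => [|[|T] IH]; [by rewrite big_geq | by rewrite big_geq |].
by rewrite big_nat_recr //=; move: IH => /=; lia.
Qed.

Lemma sum_chebyshev_coef_large p n T :
  prime p -> n < p ^ 2 ->
  \sum_(1 <= j < T) chebyshev_coef (n %/ p ^ j) <= chebyshev_coef (n %/ p).
Proof.
move=> pp np; case: T => [|[|T]]; [by rewrite big_geq | by rewrite big_geq |].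
rewrite big_nat_recl // big_nat big1.
  by rewrite addn0 expn1.
move=> j /andP[j0 _]; rewrite divn_small //.
by apply: leq_trans np _; rewrite (leq_exp2l _ _ (prime_gt1 pp)).
Qed.

(** In (6n)! n! / ((3n)! (2n)!^2), a prime p <= sqrt (6n) contributes a power at
    most 6n; a larger prime has exponent at most 1, and exponent 0 if it lies in
    (6n/5, 2n].  The primes up to 6n/5 are bounded by the primorial and those of
    (2n, 4n] by the binomial coefficient of 4n and 2n, so that a lower bound of
    the quotient becomes one for the product of the primes in (4n, 6n]. *)
Lemma factorial_quotient_le n r :
  0 < n -> 6 * n < r.+1 ^ 2 ->
  (6 * n)`! * n`! <= (3 * n)`! * ((2 * n)`!) ^ 2 *
    ((6 * n) ^ r * (4 ^ ((6 * n) %/ 5) * (2 ^ (4 * n) * primeprod (4 * n) (6 * n)))).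
Proof.
move=> n0 hr.
pose Z1 := \prod_(1 <= p < r.+1 | prime p) p ^ trunc_log p (6 * n).
pose Z2 := primeprod 0 ((6 * n) %/ 5).
pose Z3 := 'C(4 * n, 2 * n).
pose Z4 := primeprod (4 * n) (6 * n).
have Z1_gt0 : 0 < Z1 by apply: prodn_cond_gt0 => p pp; rewrite expn_gt0 prime_gt0.
have Z2_gt0 : 0 < Z2 by exact: primeprod_gt0.
have Z3_gt0 : 0 < Z3 by rewrite bin_gt0; lia.
have Z4_gt0 : 0 < Z4 by exact: primeprod_gt0.
have hdvd : (6 * n)`! * n`! %| (3 * n)`! * ((2 * n)`!) ^ 2 * (Z1 * (Z2 * (Z3 * Z4))).
  apply: dvdn_from_logn => [||p pp];
    rewrite ?(muln_gt0, fact_gt0, expn_gt0, Z1_gt0, Z2_gt0, Z3_gt0) //.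
  rewrite !lognM ?(muln_gt0, fact_gt0, expn_gt0, Z1_gt0, Z2_gt0, Z3_gt0) //.
  rewrite !(@logn_fact_widen p _ (6 * n)) //; try lia.
  set S := \sum_(1 <= j < (6 * n).+1) chebyshev_coef ((6 * n) %/ p ^ j).
  suff hS : S <= logn p Z1 + (logn p Z2 + (logn p Z3 + logn p Z4)).
    apply: leq_trans (leq_add (leqnn _) hS).
    rewrite addnn -mul2n big_distrr /= -!big_split /=; apply: leq_sum => j _.
    exact: div_chebyshev_coef.
  have [pr|rp] := leqP p r.
    apply: leq_trans (sum_chebyshev_coef_le _ _ pp) _; apply: leq_trans _ (leq_addr _ _).
    rewrite -pfactor_dvdn // /Z1 -big_filter (bigD1_seq p) ?dvdn_mulr //=.
      by rewrite mem_filter pp mem_index_iota prime_gt0.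
    by rewrite filter_uniq ?iota_uniq.
  have p2 : 6 * n < p ^ 2 by apply: leq_trans hr _; rewrite leq_exp2r.
  apply: leq_trans (sum_chebyshev_coef_large _ pp p2) _.
  have h3 : 2 * n < p <= 4 * n -> 0 < logn p Z3.
    move=> hp; rewrite -pfactor_dvdn // expn1; apply: prime_dvd_bin => //; lia.
  rewrite /Z2 /Z4 !logn_primeprod //; move: h3.
  have := divn_eq (6 * n) p; have := ltn_pmod (6 * n) (prime_gt0 pp).
  rewrite /chebyshev_coef !inE; move: (6 * n %/ p) => W hmod hW h3.
  have [->//|W0] := posnP W.
  (* The exponent is 0 for W = 0, 3, 4; W >= 5 means p <= 6n/5, and W = 1, 2 mean
     2n < p <= 6n. *)
  have [W5|W5] := leqP 5 W.
    have -> : 0 < p <= 6 * n %/ 5 by rewrite prime_gt0 //= leq_divRL //; nia.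
    by rewrite addnCA; apply: leq_trans (leq_b1 _) (leq_addr _ _).
  case: (W =P 1) => [W1|W1].
    subst W; case: (leqP p (4 * n)) => hp.
      by have := h3 _; lia.
    by rewrite (_ : p <= 6 * n) ?addnA ?leq_addl //; lia.
  case: (W =P 2) => [W2|W2].
    subst W; have := h3 _; lia.
  have : (W == 3) || (W == 4) by lia.
  by case/orP=> /eqP ->.
apply: leq_trans (dvdn_leq _ hdvd) _.
  by rewrite ?(muln_gt0, fact_gt0, expn_gt0, Z1_gt0, Z2_gt0, Z3_gt0).
rewrite leq_mul // !leq_mul //; last 1 first.
- rewrite /Z3; case: (4 * n) (muln_gt0 4 n) => [|m _]; first by rewrite n0.
  by apply: leq_trans (bin_leq_exp2 m _) _; rewrite leq_exp2l.
- rewrite /Z1 big_mkcond /= -[r in _ ^ r]subn0 -(subSS 0) -prod_nat_const_nat.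
  apply: leq_prod => p _; case: ifP => [pp|_]; last by rewrite muln_gt0.
  by rewrite trunc_logP ?prime_gt1 // muln_gt0.
- exact: primorial_le.
Qed.

(** The ratio of two consecutive values of (6n)! n! / ((3n)! (2n)!^2) is
    6 (6n + 1) (6n + 5) / ((n + 1) (2n + 1)), which is at least 108 n / (n + 1). *)
Lemma factorial_quotient_ge n :
  0 < n -> 108 ^ n * ((3 * n)`! * ((2 * n)`!) ^ 2) <= 4 * n * ((6 * n)`! * n`!).
Proof.
elim: n => // -[|n] IH _; first by rewrite !factS fact0.
move/(_ isT): IH; move: n.+1 (ltn0Sn n) => {}n n0 IH.
have -> : (6 * n.+1)`! = (6*n+1)*(6*n+2)*(6*n+3)*(6*n+4)*(6*n+5)*(6*n+6)*(6*n)`!.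
  rewrite (_ : 6 * n.+1 = (6 * n).+4.+2); last lia.
  by rewrite !factS; ring.
have -> : (3 * n.+1)`! = (3*n+1)*(3*n+2)*(3*n+3)*(3*n)`!.
  rewrite (_ : 3 * n.+1 = (3 * n).+3); last lia.
  by rewrite !factS; ring.
have -> : (2 * n.+1)`! = (2*n+1)*(2*n+2)*(2*n)`!.
  rewrite (_ : 2 * n.+1 = (2 * n).+2); last lia.
  by rewrite !factS; ring.
rewrite (factS n) expnS.
move: (6 * n)`! (3 * n)`! (2 * n)`! n`! (108 ^ n) IH => A B C D E IH.
pose Y := (3*n+1)*(3*n+2)*(3*n+3)*((2*n+1)*(2*n+2))^2.
pose X := (6*n+1)*(6*n+2)*(6*n+3)*(6*n+4)*(6*n+5)*(6*n+6)*(n+1).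
have XY : 108 * n * Y <= (n + 1) * X.
  have -> : 108 * n * Y = (3*n+1)*(3*n+2)*(3*n+3) * (n+1)^2 * (2*n+1) * (432 * n * (2*n+1)).
    by rewrite /Y; ring.
  have -> : (n+1) * X = (3*n+1)*(3*n+2)*(3*n+3) * (n+1)^2 * (2*n+1) * (24*(6*n+1)*(6*n+5)).
    by rewrite /X; ring.
  rewrite leq_mul //; lia.
apply: (@leq_trans (108 * Y * (E * (B * C ^ 2)))); first by rewrite /Y; apply/eq_leq; ring.
apply: leq_trans (leq_mul (leqnn _) IH) _.
apply: (@leq_trans (108 * n * Y * (4 * A * D))); first by apply/eq_leq; ring.
apply: leq_trans (leq_mul XY (leqnn _)) _.
by rewrite /X; apply/eq_leq; ring.
Qed.

(** * Many primes between 20 k and 30 k *)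

Lemma exp2_dominates z : 11 <= z -> 100 * z.+1 <= 2 ^ z.
Proof.
elim: z => // z IH; rewrite leq_eqVlt => /orP[/eqP <- //|/IH]; rewrite expnS; lia.
Qed.

Lemma ex_sqrt n : exists r, r ^ 2 <= n < r.+1 ^ 2.
Proof.
elim: n => [|n [r hr]]; first by exists 0.
have [h|h] := leqP (r.+1 ^ 2) n.+1; [exists r.+1 | exists r]; move: hr h; rewrite -!mulnn; nia.
Qed.

Definition primes_between (a b : nat) : seq nat := [seq p <- index_iota a.+1 b.+1 | prime p].

Lemma primeprod_le a b : 0 < b -> primeprod a b <= b ^ size (primes_between a b).
Proof.
move=> b0; rewrite /primeprod -big_filter -/(primes_between a b).
have : all (fun p => p <= b) (primes_between a b).
  by apply/allP => p; rewrite mem_filter mem_index_iota ltnS => /andP[_ /andP[_ ->]].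
elim: (primes_between a b) => [|p s IH] /=; first by rewrite big_nil.
by case/andP=> pb /IH h; rewrite big_cons expnS leq_mul.
Qed.

(** Together with 108 = 2^2 3^3 this gives 108^5 >= 2^33, to be compared with the
    factor 4^6 16^5 = 2^32 lost in [factorial_quotient_le] for n = 5. *)
Lemma exp2_23_le_exp3_15 k : 2 ^ (23 * k) <= 3 ^ (15 * k).
Proof.
case: k => [|k]; first by rewrite !muln0.
rewrite !expnM (leq_exp2r _ _ (ltn0Sn k)).
have -> m : m ^ 23 = m ^ 7 * m ^ 8 * m ^ 8 by rewrite -!expnD.
have -> m : m ^ 15 = m ^ 5 * m ^ 5 * m ^ 5 by rewrite -!expnD.
have -> : 2 ^ 7 = 128 by [].
have -> : 2 ^ 8 = 256 by [].
have -> : 3 ^ 5 = 243 by [].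
lia.
Qed.

(** For n = 5k the two bounds on the factorial quotient leave a factor 2 ^ k, up to
    powers of 30k, for the product of the primes in (20k, 30k]. *)
Lemma exp2_le_primes k r : 0 < k -> 30 * k < r.+1 ^ 2 ->
  2 ^ k <= (30 * k) ^ (r + size (primes_between (20 * k) (30 * k))).+1.
Proof.
move=> k0 hr; pose n := 5 * k.
have n0 : 0 < n by rewrite muln_gt0.
have e6 : 6 * n = 30 * k by rewrite /n; lia.
have e4 : 4 * n = 20 * k by rewrite /n; lia.
have := factorial_quotient_ge n0; have := @factorial_quotient_le n r n0.
rewrite e6 => /(_ hr); set B := (3 * n)`! * _; set A := (30 * k)`! * _; rewrite e4.
have B0 : 0 < B by rewrite muln_gt0 expn_gt0 !fact_gt0.
rewrite (_ : 30 * k %/ 5 = 6 * k); last by rewrite (_ : 30 * k = 6 * k * 5) ?mulnK //; lia.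
set Z := _ ^ r * _ => hAB hBA.
have {hAB hBA A} h : 108 ^ n <= 20 * k * Z.
  rewrite -(leq_pmul2r B0); apply: leq_trans hBA _.
  by apply: leq_trans (leq_mul (leqnn _) hAB) _; apply/eq_leq; ring.
have h108 : 2 ^ (33 * k) <= 108 ^ n.
  have -> : 108 = 2 ^ 2 * 3 ^ 3 by [].
  rewrite expnMn -!expnM /n (_ : 33 * k = 2 * (5 * k) + 23 * k); last lia.
  rewrite expnD leq_pmul2l ?expn_gt0 // (_ : 3 * (5 * k) = 15 * k); last lia.
  exact: exp2_23_le_exp3_15.
have {}h := leq_trans h108 h.
have Ze : Z = 2 ^ (32 * k) * ((30 * k) ^ r * primeprod (20 * k) (30 * k)).
  have -> : 2 ^ (32 * k) = 4 ^ (6 * k) * 2 ^ (20 * k).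
    by rewrite -[4]/(2 ^ 2) -expnM -expnD; congr (_ ^ _); lia.
  rewrite /Z; move: (4 ^ _) (2 ^ _) (_ ^ r) (primeprod _ _) => x y t u; ring.
have e33 : 33 * k = 32 * k + k by lia.
move: h; rewrite Ze e33 expnD mulnCA (leq_pmul2l (expn_gt0 2 _)) => h.
apply: leq_trans h _.
rewrite expnS leq_mul //; first lia.
by rewrite expnD leq_mul // primeprod_le // muln_gt0.
Qed.

(** With r about sqrt (30k) and at most c primes, [exp2_le_primes] would bound 2 ^ k
    by (30k) ^ (r + c + 1), which is only 2 ^ O(sqrt k log k). *)
Lemma many_primes c : exists k0, forall k, k0 <= k ->
  c < size (primes_between (20 * k) (30 * k)).
Proof.
exists ((2 * c + 1103) ^ 2) => k hk; have [r /andP[r1 r2]] := ex_sqrt (30 * k).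
have rc : 2 * c + 1102 <= r.
  rewrite leqNgt; apply/negP => h.
  have : r.+1 ^ 2 <= (2 * c + 1103) ^ 2 by rewrite leq_exp2r //; lia.
  lia.
have k0 : 0 < k by apply: leq_trans hk; rewrite expn_gt0 addn_gt0 orbT.
have := exp2_le_primes k0 r2; set s := size _ => h.
rewrite ltnNge; apply/negP => sc.
(* It suffices that log2 (r + 1) <= r / 100: then k is at most
   (r / 50) (r + c + 1), less than r^2 / 30. *)
pose z := r %/ 100.
have zr : r.+1 <= 2 ^ z.
  have z11 : 11 <= z by rewrite leq_divRL //; lia.
  by apply: leq_trans (exp2_dominates z11); rewrite /z; lia.
have h2 : 2 ^ k <= 2 ^ (z * 2 * (r + s).+1).
  apply: leq_trans h _; rewrite 2!expnM leq_exp2r //.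
  by apply: leq_trans (ltnW r2) _; rewrite leq_exp2r.
move: h2; rewrite leq_exp2l // => h2.
have zr100 : 100 * z <= r by rewrite /z; lia.
have : r * r <= 30 * k by rewrite mulnn.
have : 100 * k <= r * 2 * (r + c).+1.
  apply: leq_trans (leq_mul (leqnn 100) h2) _; rewrite !mulnA leq_mul ?leq_mul //; lia.
nia.
Qed.

(** * The action of a word on vectors *)

Local Open Scope ring_scope.

(** A letter g^e acts by the matrix with rows (1, ev) and (e, 1), e = 1 or -1, and
    a letter of the other generator by diag(z, 1), where z depends on the
    direction.  For e = -1 the matrix is the adjugate of the one for e = 1, that
    is, its inverse up to the scalar 1 - v: no division is needed, so the same
    formula makes sense over F and over the polynomials in v. *)
Definition act (R : comNzRingType) (g : generator) (v : R) (z : bool -> R)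
    (u : R * R) (s : letter) : R * R :=
  if s.1 == g then
    (u.1 + (-1) ^+ s.2 * v * u.2, (-1) ^+ s.2 * u.1 + u.2)
  else (z s.2 * u.1, u.2).

(** The lengths of the blocks, possibly empty, into which the letters g and g^-1 cut
    the word; [n] counts letters of the current block that were already read. *)
Fixpoint runs (g : generator) (n : nat) (w : seq letter) : seq nat :=
  if w is s :: w' then
    if s.1 == g then n :: runs g 0 w' else runs g n.+1 w'
  else [:: n].

Definition dir_scalar (F : fieldType) (z : F) (e : bool) : F :=
  if e then z^-1 else z.

Lemma sumn_runs g w n :
  sumn (runs g n w) = (n + count (fun s : letter => s.1 != g) w)%N.
Proof.
elim: w n => [|s w IH] n /=; first by rewrite !addn0.
by case: eqP => _ /=; rewrite IH ?add0n // addSnnS.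
Qed.

Lemma neq_generator (g C D : generator) : C != g -> D != g -> C = D.
Proof. by case: g C D => [] [] []. Qed.

Lemma same_direction (g : generator) (s t : letter) :
  s.1 != g -> t.1 != g -> t != letter_inv s -> t.2 = s.2.
Proof.
case: s t => [C e] [D r] /= sg tg; rewrite /letter_inv /= (neq_generator sg tg).
by case: e r => [] [] //; rewrite eqxx.
Qed.

Lemma act_rmorph (R S : comNzRingType) (f : {rmorphism R -> S}) g v z u s :
  let fpair x := (f x.1, f x.2) in
  fpair (act g v z u s) = act g (f v) (f \o z) (fpair u) s.
Proof.
by rewrite /act /=; case: ifP => _ /=; rewrite !(rmorphD, rmorphM, rmorph_sign).
Qed.

(** The bounds are on sizes, that is, degrees plus one: after m letters g or g^-1
    the first coordinate has degree at most m/2 and the second one at most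
    (m - 1)/2.  The shift between them is what makes a letter cost half a degree:
    the first coordinate grows by v times the second one, and the second by the
    first. *)
Lemma size_act_poly (R : comNzRingType) g (z : bool -> R) w m (u : {poly R} * {poly R}) :
  (size u.1 <= m./2.+1)%N -> (size u.2 <= uphalf m)%N ->
  (size (foldl (act g 'X (fun e => (z e)%:P)) u w).2
     <= uphalf (m + count (fun s : letter => s.1 == g) w))%N.
Proof.
have sizeX : size ('X : {poly R}) = 2%N by exact: size_polyX.
elim: w m u => [|s w IH] m u h1 h2 /=; first by rewrite addn0.
rewrite addnA {2}/act; case: ifP => _ /=; rewrite ?addn1 ?addn0; apply: IH => /=;
  rewrite ?uphalfE in h2 *.
- apply: leq_trans (size_polyD _ _) _; rewrite geq_max; apply/andP; split.
    by apply: leq_trans h1 _; lia.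
  rewrite -mulrA -signr_odd; case: (odd _); rewrite ?expr1 ?expr0 ?mulN1r ?size_polyN ?mul1r;
  by apply: leq_trans (size_polyMleq _ _) _; rewrite sizeX.
- apply: leq_trans (size_polyD _ _) _; rewrite geq_max; apply/andP; split; last first.
    by apply: leq_trans h2 _; lia.
  by rewrite -signr_odd; case: (odd _); rewrite ?expr1 ?expr0 ?mulN1r ?size_polyN ?mul1r.
- by rewrite mul_polyC; apply: leq_trans (size_scale_leq _ _) _.
- by [].
Qed.

(** For n > 0, the condition that z^n is neither 1 nor -1 for z of order [m]; empty
    blocks are harmless by reducedness. *)
Definition good_run (m n : nat) : bool := (0 < n)%N ==> ~~ (m %| 2 * n)%N.

Lemma prim_root_neq0 (F : fieldType) (z : F) m : m.-primitive_root z -> z != 0.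
Proof.
move=> pz.
by rewrite -unitfE -(unitrX_pos _ (prim_order_gt0 pz)) (prim_expr_order pz) unitr1.
Qed.

Lemma dir_scalar_expr_neq (F : fieldType) (z : F) m n e :
  m.-primitive_root z -> (0 < n)%N -> good_run m n ->
  dir_scalar z e ^+ n != 1 /\ dir_scalar z e ^+ n != -1.
Proof.
move=> pz n0; rewrite /good_run n0 /= => h.
suff h2 : dir_scalar z e ^+ (2 * n) != 1.
  have {}h2 : (dir_scalar z e ^+ n) ^+ 2 != 1 by rewrite -exprM mulnC.
  by move: h2; rewrite sqrf_eq1 negb_or => /andP.
rewrite /dir_scalar; case: e; rewrite ?exprVn ?invr_eq1 -(prim_order_dvd pz) //.
Qed.

(** At v = 1 a letter g^s (s = 1 or -1) maps (x, y) to (x + sy) (1, s), so the vector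
    keeps the form c (z^(+-n), r), where r is the sign of the last letter g^(+-1)
    and n the number of letters read since.  The next letter g^s multiplies c by
    z^(+-n) + sr. *)
Lemma act1_neq0_rec (F : fieldType) g (z : F) m w t n (c : F) e (r : bool) :
  (2%:R : F) != 0 -> m.-primitive_root z -> c != 0 ->
  path (fun s t : letter => t != letter_inv s) t w ->
  all (good_run m) (runs g n w) ->
  (if n is 0 then t = (g, r) else t.1 != g /\ t.2 = e) ->
  (foldl (act g 1 (dir_scalar z)) (c * dir_scalar z e ^+ n, c * (-1) ^+ r) w).2 != 0.
Proof.
move=> two0 pz; elim: w t n c e r => [|s w IH] t n c e r c0 /=.
  by move=> _ _ _; rewrite mulf_neq0 // signr_eq0.
case/andP=> hs pw; rewrite {2}/act /=; case: ifP => [/eqP sg|sg].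
  move=> /= /andP[gn gw] ht.
  set c' := c * dir_scalar z e ^+ n + (-1) ^+ s.2 * (c * (-1) ^+ r).
  have c'0 : c' != 0.
    rewrite /c' mulrCA -mulrDr mulf_neq0 //.
    (* n = 0: two consecutive letters g^r, g^s have r = s in a reduced word. *)
    case: n gn ht {c'} => [|n] gn ht.
      have -> : s.2 = r.
        move: hs; rewrite ht /letter_inv /=; case: s sg {pw gn} => sc sb /= ->.
        by case: sb r {ht gw} => [] [] //=; rewrite eqxx.
      by rewrite expr0 -expr2 sqrr_sign -mulr2n.
    have [z1 zN1] := dir_scalar_expr_neq (n := n.+1) e pz isT gn.
    by case: s.2 r {ht} => [] []; rewrite /= ?expr0 ?expr1 ?mulr1 ?mul1r ?mulN1r ?opprK
       ?addr_eq0 ?opprK.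
  have -> : (c * dir_scalar z e ^+ n + (-1) ^+ s.2 * 1 * (c * (-1) ^+ r),
             (-1) ^+ s.2 * (c * dir_scalar z e ^+ n) + c * (-1) ^+ r) =
     (c' * dir_scalar z e ^+ 0, c' * (-1) ^+ s.2).
    rewrite /c'; congr pair; first by ring.
    have ss : (-1) ^+ s.2 * (-1) ^+ s.2 = 1 :> F by rewrite -expr2 sqrr_sign.
    transitivity ((-1) ^+ s.2 * (c * dir_scalar z e ^+ n)
                  + ((-1) ^+ s.2 * (-1) ^+ s.2) * (c * (-1) ^+ r)); last by ring.
    by rewrite ss mul1r.
  by apply: (IH s) => //; case: s sg {hs pw c' c'0} => ? ? /= ->.
move=> gw ht.
have [e' [he he']] : exists e', s.2 = e' /\ dir_scalar z e ^+ n = dir_scalar z e' ^+ n.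
  exists s.2; split=> //; case: n ht {gw} => [|n]; rewrite ?expr0 // => -[tg te].
  by rewrite -te (same_direction tg _ hs) // sg.
rewrite he he' mulrCA -exprS; apply: (IH s) => //=; split=> //; by rewrite sg.
Qed.

Lemma act1_neq0 (F : fieldType) g (z : F) m w :
  (2%:R : F) != 0 -> m.-primitive_root z -> reduced w ->
  all (good_run m) (runs g 0 w) -> has (fun s : letter => s.1 == g) w ->
  (foldl (act g 1 (dir_scalar z)) (1, 0) w).2 != 0.
Proof.
move=> two0 pz.
suff: forall c n, c != 0 -> reduced w -> all (good_run m) (runs g n w) ->
  has (fun s : letter => s.1 == g) w ->
  (foldl (act g 1 (dir_scalar z)) (c, 0) w).2 != 0.
  by apply; exact: oner_neq0.
have zn0 e : dir_scalar z e != 0.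
  by rewrite /dir_scalar; case: e; rewrite ?invr_eq0 (prim_root_neq0 pz).
elim: w => [|s w IH] //= c n c0 rw; rewrite {2}/act /=; case: ifP => [/eqP sg|sg].
  move=> /andP[_ gw] _; rewrite mulr0 !addr0.
  have := @act1_neq0_rec F g z m w s 0 c false s.2 two0 pz c0 rw gw.
  rewrite expr0 mulr1 mulrC; apply; by case: s sg {rw}=> ? ? /= ->.
move=> gw hw; apply: (IH _ n.+1) => //; first by rewrite mulf_neq0.
exact: path_sorted rw.
Qed.

(** The second coordinate of w applied to (1, 0) is a polynomial in v that does not
    vanish at 1; its degree is less than q - 1, so the elements other than 1 cannot
    all be roots. *)
Lemma exists_act_neq0 (F : finFieldType) g (z : F) w :
  (2%:R : F) != 0 -> #|F|.-1.-primitive_root z -> reduced w ->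
  all (good_run #|F|.-1) (runs g 0 w) -> has (fun s : letter => s.1 == g) w ->
  (count (fun s : letter => s.1 == g) w <= 2 * #|F|.-1)%N ->
  exists2 v : F, v != 1 & (foldl (act g v (dir_scalar z)) (1, 0) w).2 != 0.
Proof.
move=> two0 pz rw gw hw cw.
pose Y : {poly F} := (foldl (act g 'X (fun e => (dir_scalar z e)%:P)) (1, 0) w).2.
have hY v : Y.[v] = (foldl (act g v (dir_scalar z)) (1, 0) w).2.
  suff hu u : (foldl (act g 'X (fun e => (dir_scalar z e)%:P)) u w).2.[v]
      = (foldl (act g v (dir_scalar z)) (u.1.[v], u.2.[v]) w).2.
    by rewrite /Y hu /= hornerC horner0.
  elim: w u {rw gw hw cw Y} => //= s w IH u; rewrite IH; congr (foldl _ _ _).2.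
  rewrite -!horner_evalE (act_rmorph (horner_eval v)) /= !horner_evalE hornerX.
  rewrite /act /=; case: ifP => // _; by rewrite horner_evalE hornerC.
have Y0 : Y != 0.
  by apply: contraTneq (act1_neq0 two0 pz rw gw hw) => Y0; rewrite -hY Y0 horner0 eqxx.
have [/existsP[v /andP[v1 hv]]|] := boolP [exists v : F, (v != 1) && (Y.[v] != 0)].
  by exists v; rewrite -?hY.
rewrite negb_exists => /forallP h; exfalso.
have := @max_poly_roots _ Y (enum (predC1 (1 : F))) Y0.
rewrite enum_uniq -cardE.
have -> : all (root Y) (enum (predC1 (1 : F))).
  apply/allP => v; rewrite mem_enum inE => v1; move: (h v); rewrite v1 /= negbK.
  by rewrite rootE.
move=> /(_ isT isT); rewrite cardC1 ltnNge => /negP; apply.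
have := @size_act_poly _ g (dir_scalar z) w 0 (1, 0); rewrite size_poly1 size_poly0.
move=> /(_ isT isT) H; apply: leq_trans H _.
rewrite add0n uphalfE; apply: leq_trans (half_leq (_ : _ <= (2 * #|F|.-1).+1)%N) _ => //.
by rewrite mul2n -uphalfE uphalf_double.
Qed.

(** * The projective line as a permutation digraph *)

(** The point (x : y) is represented by x / y, and the point at infinity (1 : 0) by
    [None]. *)
Definition proj (F : fieldType) (u : F * F) : option F :=
  if u.2 == 0 then None else Some (u.1 / u.2).

Definition rep (F : fieldType) (x : option F) : F * F :=
  if x is Some y then (y, 1) else (1, 0).

Definition scale (F : fieldType) (c : F) (u : F * F) : F * F := (c * u.1, c * u.2).

Lemma projK (F : fieldType) (u : F * F) :
  u != 0 -> exists2 c, c != 0 & u = scale c (rep (proj u)).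
Proof.
case: u => x y u0; rewrite /proj /scale /=; case: eqP => [y0|/eqP y0] /=.
  exists x; last by rewrite mulr1 mulr0 y0.
  by apply: contraNneq u0 => ->; rewrite y0.
by exists y => //; rewrite mulr1 mulrC divfK.
Qed.

Lemma repK (F : fieldType) : cancel (@rep F) (@proj F).
Proof. by case=> [y|]; rewrite /proj /= ?oner_eq0 ?divr1 ?eqxx. Qed.

Lemma rep_neq0 (F : fieldType) (x : option F) : rep x != 0.
Proof. by case: x => [y|]; rewrite /= xpair_eqE oner_eq0 ?andbF. Qed.

Lemma proj_scale (F : fieldType) (c : F) u : c != 0 -> proj (scale c u) = proj u.
Proof.
move=> c0; rewrite /proj /= mulf_eq0 (negPf c0) /=; case: eqP => // /eqP y0.
by rewrite -mulf_div divff ?mul1r.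
Qed.

Lemma act_scale (F : fieldType) g v z (c : F) u s :
  act g v z (scale c u) s = scale c (act g v z u s).
Proof. by rewrite /act /scale /=; case: ifP => _ /=; congr pair; ring. Qed.

Lemma actK (F : fieldType) g v (z : F) s :
  v != 1 -> z != 0 ->
  exists2 c, c != 0 &
    forall u, act g v (dir_scalar z) (act g v (dir_scalar z) u s) (letter_inv s) = scale c u.
Proof.
move=> v1 z0; case: (boolP (s.1 == g)) => sg.
  exists (1 - v) => [|[x y]]; first by rewrite subr_eq0 eq_sym.
  rewrite /act /= sg /scale /=; case: s.2 => /=; rewrite ?expr0 ?expr1; congr pair; ring.
exists 1; first exact: oner_neq0.
case=> x y; rewrite /act /= (negPf sg) /scale /= !mul1r; congr pair.
by rewrite mulrA /dir_scalar; case: s.2 => /=; rewrite ?mulVf ?mulfV ?mul1r.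
Qed.

Lemma act_neq0 (F : fieldType) g v (z : F) u s :
  v != 1 -> z != 0 -> u != 0 -> act g v (dir_scalar z) u s != 0.
Proof.
move=> v1 z0; have [c c0 h] := actK g s v1 z0; apply: contraNneq => h0.
move: (h u); rewrite h0 => e.
have : act g v (dir_scalar z) 0 (letter_inv s) = 0.
  by rewrite /act /= !mulr0 !addr0; case: ifP.
rewrite e /scale; case: {h h0 e} u => x y [/eqP + /eqP].
by rewrite !mulf_eq0 (negPf c0) /= => /eqP -> /eqP ->.
Qed.

Definition moebius (F : fieldType) g v (z : F) (s : letter) (x : option F) : option F :=
  proj (act g v (dir_scalar z) (rep x) s).

Lemma moebius_proj (F : fieldType) g v (z : F) s u :
  v != 1 -> z != 0 -> u != 0 ->
  moebius g v z s (proj u) = proj (act g v (dir_scalar z) u s).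
Proof.
move=> v1 z0 /projK[c c0 e].
by rewrite [in RHS]e act_scale proj_scale.
Qed.

Lemma moebiusK (F : fieldType) g v (z : F) s :
  v != 1 -> z != 0 ->
  cancel (moebius g v z s) (moebius g v z (letter_inv s)).
Proof.
move=> v1 z0 x; rewrite {2}/moebius moebius_proj ?act_neq0 ?rep_neq0 //.
by have [c c0 ->] := actK g s v1 z0; rewrite proj_scale ?repK.
Qed.

Lemma foldl_moebius (F : fieldType) g v (z : F) w u :
  v != 1 -> z != 0 -> u != 0 ->
  foldl (fun x s => moebius g v z s x) (proj u) w = proj (foldl (act g v (dir_scalar z)) u w).
Proof.
move=> v1 z0; elim: w u => //= s w IH u u0.
by rewrite moebius_proj // IH // act_neq0.
Qed.

Definition moebius_digraph (F : finFieldType) g v (z : F) (v1 : v != 1) (z0 : z != 0) :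
    lpdigraph :=
  @LPDigraph (option F) (fun C => perm (can_inj (moebiusK g (C, false) v1 z0))).

Lemma last_walk (D : lpdigraph) w (x : vertex D) :
  last x (walk w x) = foldl (@step D) x w.
Proof. by elim: w x => //= s w IH x; rewrite -IH. Qed.

Lemma step_moebius (F : finFieldType) g v (z : F) (v1 : v != 1) (z0 : z != 0) x s :
  @step (moebius_digraph g v1 z0) x s = moebius g v z s x.
Proof.
rewrite /step; case: s => C [] /=; last by rewrite permE.
by apply: (perm_inj (s := edge (moebius_digraph g v1 z0) C)); rewrite permKV permE
  (moebiusK g (C, true)).
Qed.

Lemma walk_moebius (F : finFieldType) g v (z : F) (v1 : v != 1) (z0 : z != 0) u w :
  u != 0 ->
  @closed_walk (moebius_digraph g v1 z0) w (proj u) ->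
  proj (foldl (act g v (dir_scalar z)) u w) = proj u.
Proof.
move=> u0; rewrite /closed_walk last_walk -(foldl_moebius _ _ v1 z0 u0).
move=> {2}<-; elim: w (proj u) => //= s w IH x.
by rewrite -step_moebius IH.
Qed.

(** * Non-closed walks on the projective line *)

Lemma finField_prim_root (F : finFieldType) : exists z : F, #|F|.-1.-primitive_root z.
Proof.
have q1 : (1 < #|F|)%N by exact: finNzRing_gt1.
have h : all #|F|.-1.-unity_root (enum (predC1 (0 : F))).
  apply/allP => x; rewrite mem_enum inE => x0; apply/unity_rootP.
  by apply: (mulfI x0); rewrite mulr1 -exprS prednK ?expf_card // ltnW.
have [||z _ hz] := hasP (cyclic.has_prim_root _ h (enum_uniq _) _).
- by rewrite -subn1 subn_gt0.
- by rewrite -cardE cardC1.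
by exists z.
Qed.

(** The walk starts at (1 : 0), which the other generator fixes, so that the word is
    tested by its letters g.  If it has none, then it is a power of the other
    generator, and the start is (1 : 1) instead. *)
Lemma nonclosed_digraph (F : finFieldType) g w :
  (2%:R : F) != 0 -> w <> [::] -> reduced w ->
  all (good_run #|F|.-1) (runs g 0 w) ->
  (count (fun s : letter => s.1 == g) w <= 2 * #|F|.-1)%N ->
  exists (D : lpdigraph) (v : vertex D), #|vertex D| = #|F|.+1 /\ ~ closed_walk w v.
Proof.
move=> two0 wn rw gw cw; have [z hz] := finField_prim_root F.
have z0 := prim_root_neq0 hz.
case: (boolP (has (fun s : letter => s.1 == g) w)) => hw.
  have [v v1 hv] := exists_act_neq0 two0 hz rw gw hw cw.
  exists (moebius_digraph g v1 z0), (proj (1, 0)); split; first by rewrite /= card_option.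
  move=> /walk_moebius -/(_ (rep_neq0 None)).
  by rewrite /proj (negPf hv) eqxx.
have v1 : (0 : F) != 1 by rewrite eq_sym oner_neq0.
exists (moebius_digraph g v1 z0), (proj (1, 1)); split; first by rewrite /= card_option.
move=> /walk_moebius -/(_ (rep_neq0 (Some 1))).
case: w wn rw gw hw {cw} => // s w _ rw gw.
rewrite -all_predC /= => /andP[sg hw].
have foldE t n c : t.1 != g -> path (fun s t : letter => t != letter_inv s) t w ->
    all (good_run #|F|.-1) (runs g n.+1 w) ->
    exists2 k, good_run #|F|.-1 k.+1 &
      foldl (act g 0 (dir_scalar z)) (dir_scalar z t.2 ^+ n.+1, c) w
        = (dir_scalar z t.2 ^+ k.+1, c).
  elim: w t n {sg rw gw} hw => [|r w IH] t n /= => [_ _ _|/andP[rg hw] tg].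
    by rewrite andbT => gn; exists n.
  case/andP=> hr pw; rewrite {2}/act /= (negPf rg) => gn.
  rewrite -(same_direction tg rg hr) -exprS; exact: IH.
rewrite {2}/act /= (negPf sg) mulr1 -[dir_scalar z s.2]expr1.
move: gw; rewrite /= (negPf sg) => gw.
have [k gk ->] := foldE s 0%N 1 sg rw gw.
have [k1 _] := dir_scalar_expr_neq (n := k.+1) s.2 hz isT gk.
rewrite /proj /= oner_eq0 !divr1 => -[] /eqP.
by rewrite (negPf k1).
Qed.

Local Close Scope ring_scope.

(** * The choice of the prime *)

(** If p - 1 divides 2n with n a nonzero run, then n >= L / 8 and the quotient is at most 8.
    At most 8 runs are that long, so at most 64 values of p are excluded. *)
Lemma exists_good_modulus (L : nat) (rs ps : seq nat) :
  0 < L -> sumn rs <= L -> uniq ps -> 64 < size ps ->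
  {in ps, forall p, L <= 4 * p.-1} ->
  exists2 p, p \in ps & all (good_run p.-1) rs.
Proof.
move=> L0 hs ups szp hp.
pose long := [seq n <- rs | L <= 8 * n].
have long8 : size long <= 8.
  rewrite -(leq_pmul2r L0) (leq_trans _ (_ : 8 * sumn rs <= 8 * L)) ?leq_mul2l //.
  rewrite /long; elim: (rs) => //= n s IH; case: ifP => /= h; lia.
pose bad := [seq (2 * n %/ c).+1 | n <- long, c <- iota 1 8].
have [h|/allPn[p pps pbad]] := boolP (all (mem bad) ps).
  have := uniq_leq_size ups (allP h); rewrite size_allpairs size_iota.
  by rewrite leqNgt (leq_trans _ szp) // ltnS (leq_mul long8 (leqnn 8)).
exists p => //; apply/allP => n nrs; apply/implyP => n0; apply: contra pbad => /dvdnP[c hc].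
have nL : n <= L.
  apply: leq_trans hs; elim: (rs) nrs => //= m s IH; rewrite in_cons => /orP[/eqP ->|/IH]; lia.
have := hp p pps => hpL.
have c0 : 0 < c by lia.
have c8 : c <= 8 by nia.
rewrite inE; apply/allpairsP; exists (n, c); rewrite mem_filter nrs mem_iota /=; split.
- by rewrite andbT; nia.
- by lia.
- by rewrite hc mulKn // prednK //; nia.
Qed.

Lemma minority_generator (w : seq letter) :
  exists g, 2 * count (fun s : letter => s.1 == g) w <= size w.
Proof.
have : count (fun s : letter => s.1 == gen_a) w + count (fun s : letter => s.1 == gen_b) w
    <= size w.
  rewrite -(count_predC (fun s : letter => s.1 == gen_a)) leq_add2l.
  by apply: sub_count => -[[] e].
have [h|h] := leqP (2 * count (fun s : letter => s.1 == gen_a) w) (size w).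
  by exists gen_a.
by exists gen_b; lia.
Qed.

Lemma Fp_two_neq0 p : prime p -> 2 < p -> (2%:R != 0 :> 'F_p)%R.
Proof.
move=> pp p2; rewrite -(dvdn_pcharf (pchar_Fp pp)); apply/negP => /dvdn_leq; lia.
Qed.

Local Open Scope ring_scope.

Theorem theorem1p4 :
  exists K : rat,
    forall w : seq letter, w <> [::] -> reduced w ->
      exists (D : lpdigraph) (v : vertex D),
        #|vertex D|%:R <= 2%:R / 5%:R * (size w)%:R + K /\ ~ closed_walk w v.
Proof.
have [k0 hk0] := many_primes 64.
(* For |w| >= L0 and k = |w| / 75 rounded down, k >= 15 gives |w| / 4 <= 20 k, and
   30 k <= 2 |w| / 5. *)
pose L0 := (75 * (k0 + 15))%N.
have [P hP pP] := prime_above (2 * L0 + 2)%N.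
exists P.+1%:R => w w0 rw.
have sumw g : (sumn (runs g 0 w) <= size w)%N by rewrite sumn_runs count_size.
have size_w : (0 < size w)%N by case: (w) w0.
have [wL|Lw] := ltnP (size w) L0.
  have hF : #|'F_P| = P by rewrite card_Fp.
  have [D [v [hD hv]]] : exists (D : lpdigraph) (v : vertex D),
      #|vertex D| = #|'F_P|.+1 /\ ~ closed_walk w v.
    apply: (@nonclosed_digraph 'F_P gen_a) => //; rewrite ?hF.
    - by apply: Fp_two_neq0 => //; lia.
    - apply/allP => n hn; apply/implyP => n0; apply/negP => /dvdn_leq.
      have : (n <= size w)%N.
        apply: leq_trans (sumw gen_a).
        by elim: (runs _ _ _) hn => //= m s IH; rewrite in_cons => /orP[/eqP ->|/IH]; lia.
      lia.
    - apply: leq_trans (count_size _ _) _; lia.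
  exists D, v; split=> //; rewrite hD hF lerDr.
  by rewrite mulr_ge0 ?divr_ge0 ?ler0n.
have [g hg] := minority_generator w.
pose k := (size w %/ 75)%N.
have kk0 : (k0 + 15 <= k)%N by rewrite leq_divRL //; lia.
have hps : (64 < size (primes_between (20 * k) (30 * k)))%N by apply: hk0; lia.
have [||p] := exists_good_modulus size_w (sumw g) _ hps.
- by rewrite filter_uniq ?iota_uniq.
- by move=> p; rewrite mem_filter mem_index_iota => /andP[_]; rewrite /k; lia.
rewrite mem_filter mem_index_iota => /andP[pp hp] gp.
have hF : #|'F_p| = p by rewrite card_Fp.
have [D [v [hD hv]]] : exists (D : lpdigraph) (v : vertex D),
    #|vertex D| = #|'F_p|.+1 /\ ~ closed_walk w v.
  apply: (@nonclosed_digraph 'F_p g) => //; rewrite ?hF //.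
  - by apply: Fp_two_neq0 => //; lia.
  - by move: hg hp; rewrite /k; lia.
exists D, v; split=> //; rewrite hD hF.
have h5 : (5 * p <= 2 * size w)%N by move: hp; rewrite /k; lia.
have {h5} : (5 * p)%:R <= (2 * size w)%:R :> rat by rewrite ler_nat.
rewrite !natrM -(addn1 p) -(addn1 P) !natrD => h5.
have : 0 <= P%:R :> rat by rewrite ler0n.
lra.
Qed.
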